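(* Let $K$ be a field of characteristic zero and let $A=M_2(K)$ be endowed with the Vasilovsky $\mathbb{Z}_2$-grading. Let $f\in K\langle X|\mathbb{Z}_2\rangle$ be a multilinear graded polynomial. Then the image of $f$ on $A$ is one of the following: $\{0\}$, $K$ (the set of scalar matrices), $(sl_2)_0$ (the set of trace zero diagonal matrices), $A_0$, or $A_1$.
   Context: Vasilovsky (canonical) $\mathbb{Z}_2$-grading on $A=M_2(K)$: $A=A_0\oplus A_1$, where $A_0$ is the set of diagonal matrices (span of $E_{1,1},E_{2,2}$) and $A_1$ is the span of $E_{1,2},E_{2,1}$. Graded polynomials: $X=X_0\cup X_1$ is a disjoint union of two countable sets of noncommuting variables, and $K\langle X|\mathbb{Z}_2\rangle$ is the free associative unital $K$-algebra on $X$; a variable $x\in X_g$ has $\mathbb{Z}_2$-degree $\deg(x)=g$. A graded polynomial in $x_1,\dots,x_m$ is multilinear if it has the form $\sum_{\sigma\in S_m}\alpha_\sigma x_{\sigma(1)}\cdots x_{\sigma(m)}$ with $\alpha_\sigma\in K$. Image: if $g_i=\deg(x_i)$, the image of $f(x_1,\dots,x_m)$ on $A$ is $\{f(a_1,\dots,a_m) : a_i\in A_{g_i},\ i=1,\dots,m\}$. *)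

(* Defs.v *)
From HB Require Import structures.
From mathcomp Require Import all_boot all_order all_algebra all_fingroup.
From mathcomp Require Import finmap.
From mathcomp.multinomials Require Import monalg.
From mathcomp Require Import boolp classical_sets.

Set Implicit Arguments.
Unset Strict Implicit.
Unset Printing Implicit Defensive.

Import GRing.Theory.
Local Open Scope ring_scope.
Local Open Scope classical_set_scope.

(* X = X_0 + X_1: the pair (g, k) is the k-th variable of X_g. *)
Notation gvar := ('Z_2 * nat)%type.

Definition gdeg (x : gvar) : 'Z_2 := x.1.

(* K<X | Z_2>, as the algebra over K of the free monoid of words in X. *)
Notation gpoly K := {malg K[{fmonom gvar}]}.

Definition gX (K : fieldType) (x : gvar) : gpoly K := << fmu x >>.

(* The x i are meant to be pairwise distinct. For m = 0 these are the
   constants, whose image is a single scalar matrix. *)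
Definition multilinear (K : fieldType) (m : nat) (x : 'I_m -> gvar)
    (f : gpoly K) : Prop :=
  exists alpha : 'S_m -> K,
    f = \sum_(s : 'S_m) alpha s *: \prod_(i < m) gX K (x (s i)).

Definition geval (K : fieldType) (v : gvar -> 'M[K]_2) (f : gpoly K) : 'M[K]_2 :=
  mmap (fun c : K => c%:M) (fun w : {fmonom gvar} => \prod_(y <- w) v y) f.

Definition vasilovsky (K : fieldType) (g : 'Z_2) : {vspace 'M[K]_2} :=
  if g == 0%R then <<[:: delta_mx 0%R 0%R; delta_mx 1%R 1%R]>>%VS
  else <<[:: delta_mx 0%R 1%R; delta_mx 1%R 0%R]>>%VS.

(* For f in the variables x, geval v f is f(a_1, ..., a_m) with
   a_i = v (x i): the values of v off the range of x play no role. *)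
Definition graded_image (K : fieldType) (m : nat) (x : 'I_m -> gvar)
    (f : gpoly K) : set 'M[K]_2 :=
  [set geval v f | v in
    [set v | forall i, v (x i) \in vasilovsky K (gdeg (x i))]].

(* Main.v *)
Require Import Defs.
From mathcomp Require Import all_boot all_order all_algebra all_fingroup.
From mathcomp Require Import finmap.
From mathcomp.multinomials Require Import monalg.
From mathcomp Require Import boolp classical_sets.

Import GRing.Theory.
Local Open Scope ring_scope.
Local Open Scope classical_set_scope.

(** Two facts carry the proof.

    The image of a multilinear map into a space [W] of dimension at most 2 is a
    vector subspace, over any field ([multilinear_image]): if it contains two
    linearly independent values, then some partial map in a single variable
    already has rank 2, so it is onto [W]; otherwise all the values lie on one
    line, which homogeneity in a single variable fills.  Monomials in
    homogeneous matrices are homogeneous, of degree the sum [g] of the degrees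
    of the variables, so this applies to the evaluation of [f] with [W] the
    component [A_g], which has dimension 2.

    The image of [f] is moreover stable under every automorphism of the graded
    algebra.  If it is a line [K w], then [w] is a common eigenvector of all of
    them, and two conjugations suffice to conclude.  The conjugation by
    [E12 + E21] exchanges the two diagonal entries and the two antidiagonal
    entries, so its eigenvalue is 1 or -1; when [w] is diagonal, this makes it
    scalar or of trace zero.  When [w] is antidiagonal, both its entries are
    nonzero, but the conjugation by [diag(2, 1)] multiplies them by [2] and
    [1/2], which are distinct in characteristic zero: so no line of [A_1] is an
    image. *)

(** * Images of multilinear maps into a plane *)

(** Multilinearity of [F] is expressed below by the linearity of the functions
    [fun u => F (upd a j u)]. *)
Definition upd {I : eqType} {V : Type} (a : I -> V) (j : I) (u : V) : I -> V :=
  fun i => if i == j then u else a i.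

Lemma upd_id {I : eqType} {V : Type} (a : I -> V) j : upd a j (a j) = a.
Proof. by apply/funext => i; rewrite /upd; case: eqP => [->|]. Qed.

Lemma upd_in {K : fieldType} {I : eqType} {V : vectType K}
    (D : I -> {vspace V}) (a : I -> V) j u :
  (forall i, a i \in D i) -> u \in D j -> forall i, upd a j u i \in D i.
Proof. by move=> aD uD i; rewrite /upd; case: eqP => [->|]. Qed.

Section FreePairs.
Context {K : fieldType} {U : vectType K}.

Lemma free_pair (w w' : U) :
  free [:: w; w'] = (w \notin <[w']>%VS) && (w' != 0).
Proof. by rewrite free_cons span_seq1 seq1_free. Qed.

Lemma free_pairC (w w' : U) : free [:: w; w'] = free [:: w'; w].
Proof. by apply: perm_free; rewrite (perm_catC [:: w] [:: w']). Qed.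

Lemma free_pair_full {W : {vspace U}} {w w' : U} :
  (\dim W <= 2)%N -> w \in W -> w' \in W -> free [:: w; w'] ->
  (W <= <[w]> + <[w']>)%VS.
Proof.
move=> dimW wW w'W fr.
have -> : (<[w]> + <[w']> = <<[:: w; w']>>)%VS by rewrite span_cons span_seq1.
have sub : (<<[:: w; w']>> <= W)%VS.
  by apply/span_subvP => y /[!inE]/orP[]/eqP->.
by rewrite -(geq_leqif (dimv_leqif_sup sub)) (eqP fr).
Qed.

End FreePairs.

Section MultilinearImage.
Context {K : fieldType} {I : eqType} {V U : vectType K}.
Variables (D : I -> {vspace V}) (W : {vspace U}) (F : (I -> V) -> U).
Hypothesis F_linear : forall a j, linear (fun u => F (upd a j u)).

Lemma multilinearD a j u u' :
  F (upd a j (u + u')) = F (upd a j u) + F (upd a j u').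
Proof. by have := F_linear a j 1 u u'; rewrite !scale1r. Qed.

Lemma multilinearZ a j k u : F (upd a j (k *: u)) = k *: F (upd a j u).
Proof.
have F0 : F (upd a j 0) = 0.
  by have := F_linear a j (-1) 0 0; rewrite scaler0 addr0 scaleN1r addNr.
by have := F_linear a j k u 0; rewrite F0 !addr0.
Qed.

(** The values of [F] when only the variables in [r] are free to move: fixing
    variables in this way makes an induction on their number possible without
    changing the index type. *)
Definition reach (r : seq I) (a : I -> V) (w : U) :=
  exists b, [/\ forall i, b i \in D i, forall i, i \notin r -> b i = a i
              & F b = w].

Hypothesis F_im : forall a, (forall i, a i \in D i) -> F a \in W.
Hypothesis dimW : (\dim W <= 2)%N.

(** Induction on [r = j :: r'].  Assume that for each value of the variable [j]
    the other variables reach only a line, and let [w], [w'] be independent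
    values, taken at [b] and [b'].  Exchanging the values of the variable [j]
    gives [c *: w'] at [upd b j (b' j)] and [d *: w] at [upd b' j (b j)].  If
    [c = 0], the value [b j + b' j] of the variable [j] reaches both [w] and
    [d *: w + w'], which are independent: a contradiction.  If [c != 0], the
    variable [j] alone, moved from [b], reaches [w] and [c *: w'], hence all
    their combinations. *)
Lemma reach_full_or_line r a : (forall i, a i \in D i) ->
  (forall w, w \in W -> reach r a w) \/
  (forall w w', reach r a w -> reach r a w' -> ~~ free [:: w; w']).
Proof.
elim: r a => [|j r IHr] a aD.
  right=> w w' [b [_ ba <-]] [b' [_ b'a <-]].
  have -> : b = b' by apply/funext=> i; rewrite ba // b'a.
  by rewrite free_pair memv_line.
have reach_cons u : u \in D j ->
    forall w, reach r (upd a j u) w -> reach (j :: r) a w.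
  move=> uD w [b [bD ba Fb]]; exists b; split=> // i; rewrite inE negb_or.
  by case/andP=> ij ir; rewrite ba // /upd (negbTE ij).
have [[u [uD full]]|no_full] := pselect (exists u, u \in D j /\
    forall w, w \in W -> reach r (upd a j u) w).
  by left=> w wW; apply: (reach_cons u) => //; apply: full.
have line u : u \in D j -> forall w w', reach r (upd a j u) w ->
    reach r (upd a j u) w' -> ~~ free [:: w; w'].
  move=> uD; case: (IHr (upd a j u)) => //; first exact: upd_in.
  by move=> full; case: no_full; exists u.
have [|nfull] := pselect (forall w, w \in W -> reach (j :: r) a w);
  [by left|right].
move=> w w' [b [bD ba Fb]] [b' [b'D b'a Fb']]; apply/negP => fr.
have reach_upd (c : I -> V) u : (forall i, c i \in D i) ->
    (forall i, i \notin j :: r -> c i = a i) -> u \in D j ->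
    reach r (upd a j u) (F (upd c j u)).
  move=> cD ca uD; exists (upd c j u); split=> // [|i ir]; first exact: upd_in.
  by rewrite /upd; case: eqP => // /eqP ij; rewrite ca // inE negb_or ij.
have wW : w \in W by rewrite -Fb F_im.
have w'W : w' \in W by rewrite -Fb' F_im.
have w'n0 : w' != 0 by move: fr; rewrite free_pair => /andP[].
have wn0 : w != 0 by move: fr; rewrite free_pairC free_pair => /andP[].
have [c Fc] : exists c, F (upd b j (b' j)) = c *: w'.
  apply/vlineP; have := line _ (b'D j) _ _ (reach_upd b (b' j) bD ba (b'D j))
    (reach_upd b' (b' j) b'D b'a (b'D j)).
  by rewrite upd_id Fb' free_pair w'n0 andbT negbK.
have [d Fd] : exists d, F (upd b' j (b j)) = d *: w.
  apply/vlineP; have := line _ (bD j) _ _ (reach_upd b' (b j) b'D b'a (bD j))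
    (reach_upd b (b j) bD ba (bD j)).
  by rewrite upd_id Fb free_pair wn0 andbT negbK.
have [c0|cn0] := eqVneq c 0.
  have uD : b j + b' j \in D j by rewrite memvD.
  have := line _ uD _ _ (reach_upd b' _ b'D b'a uD) (reach_upd b _ bD ba uD).
  rewrite !multilinearD !upd_id Fc Fd Fb Fb' c0 scale0r addr0.
  rewrite free_pair wn0 andbT negbK rpredDl ?memvZ ?memv_line // => w'w.
  by move: fr; rewrite free_pairC free_pair w'w.
case: nfull => y /(subvP (free_pair_full dimW wW w'W fr)).
case/memv_addP=> _ /vlineP[e ->] [_ /vlineP[e' ->] ->].
have uD : e *: b j + (e' / c) *: b' j \in D j by rewrite memvD ?memvZ.
exists (upd b j (e *: b j + (e' / c) *: b' j)); split.
- exact: upd_in.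
- move=> i; rewrite inE negb_or => /andP[ij ir].
  by rewrite /upd (negbTE ij) ba // inE negb_or ij.
by rewrite multilinearD !multilinearZ upd_id Fb Fc scalerA divfK.
Qed.

End MultilinearImage.

(** The index [j] witnesses that there is at least one variable: the image of a
    map of no variables is a single vector, which need not be 0. *)
Lemma multilinear_image {K : fieldType} {I : finType} {V U : vectType K}
    (D : I -> {vspace V}) (W : {vspace U}) (F : (I -> V) -> U) (j : I) :
  (forall a j, linear (fun u => F (upd a j u))) ->
  (forall a, (forall i, a i \in D i) -> F a \in W) -> (\dim W <= 2)%N ->
  exists2 L : {vspace U}, L = W \/ (exists w, L = <[w]>%VS)
    & [set F a | a in [set a | forall i, a i \in D i]] = [set w | w \in L].
Proof.
move=> F_lin F_im dimW.
set im : set U := [set F a | a in [set a | forall i, a i \in D i]].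
have im_reach w : im w <-> reach D F (enum I) (fun=> 0) w.
  split=> [[a aD <-]|[b [bD _ <-]]]; last by exists b.
  by exists a; split=> // i; rewrite mem_enum.
have D0 : forall i, (0 : V) \in D i by move=> i; exact: mem0v.
have Fscale a k : F (upd a j (k *: a j)) = k *: F a.
  by rewrite multilinearZ // upd_id.
have [full|line] := reach_full_or_line D W F F_lin F_im dimW (enum I) _ D0.
  exists W; first by left.
  rewrite eqEsubset; split=> w; last by move/full/im_reach.
  by case=> a aD <-; exact: F_im.
have [[w [imw wn0]]|zero] := pselect (exists w, im w /\ w != 0).
  exists <[w]>%VS; first by right; exists w.
  rewrite eqEsubset; split=> [w' imw' /=|w' /= /vlineP[k ->]].
    have := line w' w; rewrite !im_reach in imw imw' => /(_ imw' imw).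
    by rewrite free_pair wn0 andbT negbK.
  case: imw => a aD <-; exists (upd a j (k *: a j)); last exact: Fscale.
  by apply: upd_in => //; rewrite memvZ.
exists <[0]>%VS; first by right; exists 0.
rewrite eqEsubset; split=> w /=.
  by move=> imw; have [->|wn0] := eqVneq w 0;
    [exact: mem0v | case: zero; exists w].
case/vlineP=> k; rewrite scaler0 => ->.
exists (upd (fun=> 0) j (0 *: 0)); last by rewrite (Fscale (fun=> 0)) scale0r.
by apply: upd_in; rewrite ?scaler0.
Qed.

(** * Evaluation of multilinear polynomials *)

Section Evaluation.
Context {K : fieldType}.

Definition eval_at {m} (alpha : 'S_m -> K) (a : 'I_m -> 'M[K]_2) : 'M[K]_2 :=
  \sum_(s : 'S_m) alpha s *: \prod_(i < m) a (s i).

(** Products of variables are words, which [geval] evaluates letter by letter;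
    this avoids putting a monoid morphism structure on the evaluation of
    words. *)
Lemma geval_multilinear (m : nat) (x : 'I_m -> gvar) (alpha : 'S_m -> K) v :
  geval v (\sum_(s : 'S_m) alpha s *: \prod_(i < m) gX K (x (s i)))
  = eval_at alpha (fun i => v (x i)).
Proof.
have word (J : Type) (l : seq J) (y : J -> gvar) : exists2 w : {fmonom gvar},
    \prod_(i <- l) gX K (y i) = << w >> & w = [seq y i | i <- l] :> seq gvar.
  elim: l => [|i l [w IHw w_l]]; first by exists mone; rewrite ?big_nil ?fm1.
  exists (mmul (fmu (y i)) w); last by rewrite fmM fmU w_l.
  by rewrite big_cons IHw malgM_def fgmulUU mulr1.
rewrite /geval (raddf_sum (mmap (@scalar_mx K 2) _)) /=; apply: eq_bigr => s _.
have [w -> w_l] := word _ (index_enum 'I_m) (fun i => x (s i)).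
have -> : alpha s *: << w >> = << alpha s *g w >> :> gpoly K.
  by apply/malgP => u; rewrite mcoeffZ !mcoeffU mulrnAr mulr1.
by rewrite mmapU w_l big_map; exact: mul_scalar_mx.
Qed.

(** As the variables are distinct, values can be assigned to them
    independently. *)
Lemma graded_imageE m (x : 'I_m -> gvar) (x_inj : injective x)
    (alpha : 'S_m -> K) :
  graded_image x (\sum_(s : 'S_m) alpha s *: \prod_(i < m) gX K (x (s i)))
  = [set eval_at alpha a | a in
      [set a | forall i, a i \in vasilovsky K (gdeg (x i))]].
Proof.
rewrite eqEsubset; split=> B /=.
  by case=> v vD <-; exists (v \o x) => //; rewrite geval_multilinear.
case=> a aD <-.
pose v y := if [pick i | x i == y] is Some i then a i else 0.
have vx i : v (x i) = a i.
  by rewrite /v; case: pickP => [k /eqP/x_inj-> //|/(_ i)]; rewrite eqxx.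
exists v; first by move=> i; rewrite vx.
by rewrite geval_multilinear; congr eval_at; apply/funext.
Qed.

(** Each monomial contains the variable [j] exactly once, so as a function of
    this variable it is [u |-> L * u * R]. *)
Lemma eval_at_linear m (alpha : 'S_m -> K) a j :
  linear (fun u => eval_at alpha (upd a j u)).
Proof.
have prod_split (s : 'S_m) : exists L R : 'M[K]_2, forall u,
    \prod_(i < m) upd a j u (s i) = L * u * R.
  have: uniq [seq s i | i <- index_enum 'I_m].
    by rewrite map_inj_uniq ?index_enum_uniq //; exact: perm_inj.
  have: j \in [seq s i | i <- index_enum 'I_m].
    by apply/mapP; exists (s^-1%g j); rewrite ?mem_index_enum ?permKV.
  suff split_at l : j \in l -> uniq l -> exists L R : 'M[K]_2, forall u,
      \prod_(i <- l) upd a j u i = L * u * R.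
    by move=> jl /(split_at _ jl)[L [R E]]; exists L, R => u; rewrite -E big_map.
  case/splitPr=> l1 l2; rewrite cat_uniq /= negb_or.
  case/and3P=> _ /andP[jl1 _] /andP[jl2 _].
  have prod_upd r u : j \notin r ->
      \prod_(i <- r) upd a j u i = \prod_(i <- r) a i.
    move=> jr; apply: eq_big_seq => i il; rewrite /upd.
    by case: eqP il => // ->; rewrite (negbTE jr).
  exists (\prod_(i <- l1) a i), (\prod_(i <- l2) a i) => u.
  by rewrite big_cat big_cons /= !prod_upd // /upd eqxx mulrA.
move=> c u u'; rewrite /eval_at scaler_sumr -big_split.
apply: eq_bigr => s _ /=; have [L [R E]] := prod_split s.
rewrite !E mulrDr mulrDl -scalerAr -scalerAl scalerDr.
by rewrite scalerA mulrC -scalerA.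
Qed.

Lemma eval_at_conj {m} (alpha : 'S_m -> K) (P Q : 'M[K]_2) a :
  Q * P = 1 -> P * Q = 1 ->
  eval_at alpha (fun i => P * a i * Q) = P * eval_at alpha a * Q.
Proof.
move=> QP PQ; rewrite /eval_at mulr_sumr mulr_suml; apply: eq_bigr => s _.
rewrite -scalerAr -scalerAl; congr (_ *: _); symmetry.
apply: (big_morph (fun A => P * A * Q)); last by rewrite mulr1.
by move=> A B; rewrite -!mulrA (mulrA Q) QP mul1r.
Qed.

(** * The Vasilovsky grading *)

Lemma Z2_cases (h : 'Z_2) : h = 0 \/ h = 1.
Proof. by case: h => -[|[|//]] lt; [left|right]; apply: val_inj. Qed.

Lemma Z2_add11 : 1 + 1 = 0 :> 'Z_2.
Proof. exact: val_inj. Qed.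

(** The row and column indices of a 2 x 2 matrix are themselves elements of
    ['Z_2], and the entry [(i, j)] has degree [j - i]: in this form the grading
    is visibly compatible with products. *)
Lemma vasilovskyP {g : 'Z_2} {A : 'M[K]_2} :
  reflect (forall i j : 'Z_2, j != i + g -> A i j = 0) (A \in vasilovsky K g).
Proof.
have -> : vasilovsky K g = <<[:: delta_mx 0%R g; delta_mx 1%R (1 + g)%R]>>%VS.
  by rewrite /vasilovsky; case: (Z2_cases g) => ->; rewrite ?Z2_add11.
rewrite span_cons span_seq1; apply: (iffP idP) => [|A0].
  case/memv_addP=> _ /vlineP[c ->] [_ /vlineP[d ->] ->] i j.
  case: (Z2_cases i) => -> /negbTE; rewrite ?add0r !mxE /= => ->;
  by rewrite !mulr0 addr0.
have -> : A = A 0 g *: delta_mx 0 g + A 1 (1 + g) *: delta_mx 1 (1 + g).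
  apply/matrixP=> i j; rewrite !mxE.
  case: (Z2_cases i) => -> /=; rewrite mulr0 ?addr0 ?add0r.
    by case: eqVneq => [->|?]; rewrite ?mulr1 // mulr0 A0 ?add0r.
  by case: eqVneq => [->|?]; rewrite ?mulr1 // mulr0 A0.
by rewrite memv_add ?memvZ ?memv_line.
Qed.

Lemma vasilovsky1 : 1 \in vasilovsky K 0.
Proof. by apply/vasilovskyP=> i j; rewrite addr0 mxE eq_sym => /negbTE->. Qed.

Lemma vasilovskyM g h A B : A \in vasilovsky K g -> B \in vasilovsky K h ->
  A * B \in vasilovsky K (g + h).
Proof.
move=> /vasilovskyP A_g /vasilovskyP B_h; apply/vasilovskyP=> i j.
move=> j_i; rewrite mxE big1 // => k _.
have [k_i|?] := eqVneq k (i + g : 'Z_2); last by rewrite A_g ?mul0r.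
by rewrite B_h ?mulr0 // k_i -addrA.
Qed.

Lemma dim_vasilovsky g : (\dim (vasilovsky K g) <= 2)%N.
Proof. by rewrite /vasilovsky; case: ifP => _; apply: dim_span. Qed.

(** All the monomials have the same degree, because the degrees of the
    variables add up to [\sum_i d i] in any order. *)
Lemma eval_at_homogeneous m (d : 'I_m -> 'Z_2) (alpha : 'S_m -> K) a :
  (forall i, a i \in vasilovsky K (d i)) ->
  eval_at alpha a \in vasilovsky K (\sum_i d i).
Proof.
move=> aD; apply: rpred_sum => s _; rewrite memvZ //.
rewrite (reindex_inj (@perm_inj _ s)) /=.
by elim/big_rec2: _ => [|i g A _ A_g]; [exact: vasilovsky1|exact: vasilovskyM].
Qed.

(** A conjugation that preserves the grading preserves images, so it acts as a
    homothety on an image that is a line. *)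
Lemma eval_at_conj_line {m} {d : 'I_m -> 'Z_2} {alpha : 'S_m -> K}
    {w : 'M[K]_2} (P Q : 'M[K]_2) :
  [set eval_at alpha a | a in [set a | forall i, a i \in vasilovsky K (d i)]]
    = [set B | B \in <[w]>%VS] ->
  Q * P = 1 -> P * Q = 1 ->
  (forall g A, A \in vasilovsky K g -> P * A * Q \in vasilovsky K g) ->
  exists c, P * w * Q = c *: w.
Proof.
move=> im_w QP PQ PV; apply/vlineP.
have : [set B | B \in <[w]>%VS] w by exact: memv_line.
rewrite -im_w => -[a aD Fa]; rewrite -{1}Fa -eval_at_conj //.
pose b i := P * a i * Q; rewrite -/b.
suff : [set B | B \in <[w]>%VS] (eval_at alpha b) by apply.
by rewrite -im_w; exists b => // i; apply: PV.
Qed.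

(** * Two graded automorphisms and their common eigenvectors *)

Lemma mul_mx2E (A B : 'M[K]_2) i j : (A * B) i j = A i 0 * B 0 j + A i 1 * B 1 j.
Proof.
by rewrite mxE big_ord_recl big_ord1; congr (_ + A i _ * B _ j); apply: val_inj.
Qed.

Lemma mxtrace2E (A : 'M[K]_2) : \tr A = A 0 0 + A 1 1.
Proof.
by rewrite /mxtrace big_ord_recl big_ord1; congr (_ + A _ _); apply: val_inj.
Qed.

Lemma mx2P (A B : 'M[K]_2) : A 0 0 = B 0 0 -> A 0 1 = B 0 1 ->
  A 1 0 = B 1 0 -> A 1 1 = B 1 1 -> A = B.
Proof.
move=> e00 e01 e10 e11; apply/matrixP=> i j.
by case: (Z2_cases i) => ->; case: (Z2_cases j) => ->.
Qed.

Definition swap_mx : 'M[K]_2 := \matrix_(i, j) (i != j)%:R.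

Definition stretch_mx (c : K) : 'M[K]_2 :=
  \matrix_(i, j) (if i == j then if i == 0 then c else 1 else 0).

Lemma swap_mxK : swap_mx * swap_mx = 1.
Proof.
by apply: mx2P; rewrite mul_mx2E !mxE /= !(mulr0, mul0r, mulr1, addr0, add0r).
Qed.

Lemma stretch_mxK c : c != 0 -> stretch_mx c * stretch_mx c^-1 = 1.
Proof.
move=> cn0; apply: mx2P; rewrite mul_mx2E !mxE /=;
by rewrite !(mulr0, mul0r, mulr1, addr0, add0r) ?mulfV.
Qed.

Lemma swap_mx_odd : swap_mx \in vasilovsky K 1.
Proof.
apply/vasilovskyP=> i j; rewrite mxE; case: eqVneq => // ij.
by case: i j ij => -[|[|//]] ? [[|[|//]] ?].
Qed.

Lemma stretch_mx_even c : stretch_mx c \in vasilovsky K 0.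
Proof. by apply/vasilovskyP=> i j; rewrite addr0 mxE eq_sym => /negbTE->. Qed.

(** The eigenvalue [c] satisfies [c ^+ 2 = 1] since the swap is an
    involution. *)
Lemma swap_eigen_even {w : 'M[K]_2} {c} : w \in vasilovsky K 0 -> w != 0 ->
  swap_mx * w * swap_mx = c *: w ->
  (exists2 a, a != 0 & w = a%:M) \/ (w 0 0 != 0 /\ w 1 1 = - w 0 0).
Proof.
move=> /vasilovskyP w_even wn0 /matrixP e; have {e} := (e 0 0, e 1 1).
rewrite !mul_mx2E !mxE /= !(mulr0, mul0r, mulr1, mul1r, addr0, add0r).
move=> -[e0 e1].
have w01 : w 0 1 = 0 by rewrite w_even.
have w10 : w 1 0 = 0 by rewrite w_even.
have an0 : w 0 0 != 0.
  apply: contraNneq wn0 => a0; apply/eqP/mx2P; rewrite !mxE //.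
  by rewrite e0 a0 mulr0.
have /eqP : c ^+ 2 = 1.
  by apply: (mulIf an0); rewrite mul1r expr2 -mulrA -e0 -e1.
rewrite sqrf_eq1 => /orP[]/eqP c1; rewrite {}c1 ?mul1r ?mulN1r in e0 e1.
  by left; exists (w 0 0) => //; apply: mx2P; rewrite !mxE //=.
by right.
Qed.

(** Swap-invariance makes both antidiagonal entries nonzero; then the
    eigenvalue [d] of the stretch would be both [2] and [2^-1], whence
    [4 = 1] and [3 = 0]. *)
Lemma no_common_eigen_odd {w : 'M[K]_2} {c d} : [pchar K] =i pred0 ->
  w \in vasilovsky K 1 -> w != 0 ->
  swap_mx * w * swap_mx = c *: w ->
  stretch_mx 2 * w * stretch_mx 2^-1 = d *: w -> False.
Proof.
move=> charK /vasilovskyP w_odd wn0 /matrixP e /matrixP e'.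
have natf_neq0 n : n.+1%:R != 0 :> K by rewrite ((pcharf0P K).1 charK).
have {e} := (e 0 1, e 1 0); have {e'} := (e' 0 1, e' 1 0).
rewrite !mul_mx2E !mxE /= !(mulr0, mul0r, mulr1, mul1r, addr0, add0r).
case=> d01 d10 [c01 c10].
have: (w 0 1 != 0) && (w 1 0 != 0).
  rewrite -negb_or; apply: contra wn0 => b0; apply/eqP/mx2P;
    rewrite mxE ?(w_odd 0 0) ?(w_odd 1 1) //.
    by case/orP: b0 => /eqP b0 //; rewrite c10 b0 mulr0.
  by case/orP: b0 => /eqP b0 //; rewrite c01 b0 mulr0.
case/andP=> n01 n10.
have d2 : d = 2 by apply: (mulIf n01); rewrite -d01.
have half2 : 2^-1 = 2 :> K by apply: (mulIf n10); rewrite -d2 -d10 mulrC d2.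
have /eqP[] := natf_neq0 2.
have : 2 * 2 = 1 :> K by rewrite -{1}half2 mulVf.
by rewrite -natrM => /eqP; rewrite -subr_eq0 -(natrB _ (isT : 1 <= 4)%N) => /eqP.
Qed.

End Evaluation.

(** * Classification of the images *)

Theorem theorem16 (K : fieldType) (charK : [pchar K] =i pred0)
    (m : nat) (m_gt0 : (0 < m)%N)
    (x : 'I_m -> gvar) (x_inj : injective x)
    (f : gpoly K) (f_mul : multilinear x f) :
  graded_image x f = [set 0] \/
  graded_image x f = [set B | exists c : K, B = c%:M] \/
  graded_image x f = [set B | B \in vasilovsky K 0 /\ \tr B = 0] \/
  graded_image x f = [set B | B \in vasilovsky K 0] \/
  graded_image x f = [set B | B \in vasilovsky K 1].
Proof.
case: f_mul => alpha ->; rewrite graded_imageE //.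
pose d i := gdeg (x i); pose g := \sum_i d i.
set im := [set _ | _ in _].
have [L Lcase imL] := multilinear_image (fun i => vasilovsky K (d i))
  (vasilovsky K g) (eval_at alpha) (Ordinal m_gt0) (eval_at_linear m alpha)
  (eval_at_homogeneous m d alpha) (dim_vasilovsky g).
rewrite -/im in imL; case: Lcase => [L_full|[w L_line]].
  case: (Z2_cases g) => g_eq; rewrite imL L_full g_eq.
    by do 3 right; left.
  by do 4 right.
rewrite {L}L_line in imL.
have [w0|wn0] := eqVneq w 0.
  left; rewrite imL eqEsubset; split=> B /=; rewrite w0.
    by case/vlineP=> k ->; rewrite scaler0.
  by move=> ->; exact: mem0v.
have w_im : im w by rewrite imL; exact: memv_line.
have w_g : w \in vasilovsky K g.
  by case: w_im => a aD <-; exact: eval_at_homogeneous.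
have [c wc] : exists c, swap_mx * w * swap_mx = c *: w.
  apply: (eval_at_conj_line _ _ imL); rewrite ?swap_mxK // => h A A_h.
  have -> : h = 1 + h + 1 by rewrite addrAC Z2_add11 add0r.
  by rewrite !vasilovskyM ?swap_mx_odd.
case: (Z2_cases g) => g_eq; rewrite g_eq in w_g; last first.
  have two_neq0 : 2 != 0 :> K by rewrite ((pcharf0P K).1 charK).
  have [e we] : exists e, stretch_mx 2 * w * stretch_mx 2^-1 = e *: w.
    apply: (eval_at_conj_line _ _ imL); rewrite ?stretch_mxK //.
      by rewrite -{2}[2]invrK stretch_mxK ?invr_eq0.
    move=> h A A_h; rewrite -[h]add0r -[0 + h]addr0.
    by rewrite !vasilovskyM ?stretch_mx_even.
  by case: (no_common_eigen_odd charK w_g wn0 wc we).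
right; case: (swap_eigen_even w_g wn0 wc) => [[a an0 w_a]|[an0 w11]].
  left; rewrite imL eqEsubset w_a; split=> B /= => [/vlineP[k ->]|[k ->]].
    by exists (k * a); rewrite scale_scalar_mx.
  by apply/vlineP; exists (k / a); rewrite scale_scalar_mx divfK.
right; left; rewrite imL eqEsubset; split=> B /=.
  case/vlineP=> k ->; split; first by rewrite memvZ.
  by rewrite mxtraceZ mxtrace2E w11 subrr mulr0.
case=> B_even; rewrite mxtrace2E.
move/eqP; rewrite addr_eq0 => /eqP B00.
have /vasilovskyP w_even := w_g; move/vasilovskyP: B_even => B_even.
apply/vlineP; exists (B 0 0 / w 0 0).
apply: mx2P; rewrite mxE.
- by rewrite divfK.
- by rewrite (w_even 0 1) // (B_even 0 1) // mulr0.
- by rewrite (w_even 1 0) // (B_even 1 0) // mulr0.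
by rewrite w11 mulrN divfK // B00 opprK.
Qed.
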